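(* Let $(\mathfrak{h}\oplus A\oplus\mathfrak{h}^*,\bullet,\langle\;,\;\rangle_n)$ be the $\mathrm{L}$-quadratic left Leibniz algebra obtained from $(A,\bullet_A,\langle\;,\;\rangle_A)$ and $(\mathfrak{h},[\;,\;]_{\mathfrak{h}})$ by means of $(F,G,\omega,\theta,\Omega)$. If $A$ is a Lie algebra (with bracket $[\;,\;]_A=\bullet_A$), $Z(A)=0$ and $H^2(A)=0$, then there exist a 1-cocycle $\Omega_0$ of $\mathfrak{h}$ with values in $\wedge^2\mathfrak{h}^*$ and a linear map $U:\mathfrak{h}\to A$ such that $(\mathfrak{h}\oplus A\oplus\mathfrak{h}^*,\bullet,\langle\;,\;\rangle_n)$ is isomorphic to $(\mathfrak{h}\oplus A\oplus\mathfrak{h}^*,\circ,\langle\;,\;\rangle)$ where, for any $X,Y\in\mathfrak{h}$, $a,b\in A$, $\alpha,\beta\in\mathfrak{h}^*$, the non-vanishing products and the metric are given by $$X\circ Y=[X,Y]_{\mathfrak{h}}+\Omega_0(X)^\flat(Y),\quad a\circ b=[a,b]_A+U^*([a,b]_A),\quad X\circ\alpha=(\mathrm{ad}^{\mathfrak{h}}_X)^*\alpha,$$ $$\langle X+a+\alpha,Y+b+\beta\rangle=\langle X+a+\alpha,Y+b+\beta\rangle_n+\langle U(X),U(Y)\rangle_A-\langle a,U(Y)\rangle_A-\langle b,U(X)\rangle_A,$$ with $U^*:A\to\mathfrak{h}^*$ defined by $U^*(a)(X)=\langle a,U(X)\rangle_A$.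
   Context: Algebras are real and finite dimensional. Left Leibniz: $u\bullet(v\bullet w)=(u\bullet v)\bullet w+v\bullet(u\bullet w)$. A metric is a nondegenerate symmetric bilinear form; a left Leibniz algebra with a metric is $\mathrm{L}$-quadratic if every left multiplication is skew-symmetric. Isomorphic means by a linear bijection preserving product and metric. $Z(A)$ is the center and $H^2(A)$ the second cohomology of the Lie algebra $A$ with trivial real coefficients. Notation: $\mathrm{L}^A_a(b)=a\bullet_A b$, $\mathrm{R}^A_a(b)=b\bullet_A a$; $\mathrm{Der}(A)$ derivations of $(A,\bullet_A)$; $\mathrm{so}(A)$ skew-symmetric endomorphisms; $G(X)^*$ adjoint with respect to $\langle\;,\;\rangle_A$. $\langle X+a+\alpha,X+a+\alpha\rangle_n=2\alpha(X)+\langle a,a\rangle_A$. $((\mathrm{ad}^{\mathfrak{h}}_X)^*\alpha)(Y)=-\alpha([X,Y]_{\mathfrak{h}})$; for $\sigma\in\wedge^2\mathfrak{h}^*$, $(\mathrm{ad}_X^*\sigma)(Y,Z)=-\sigma([X,Y]_{\mathfrak{h}},Z)-\sigma(Y,[X,Z]_{\mathfrak{h}})$ and $\sigma^\flat(X)(Y)=\sigma(X,Y)$. For linear $\Omega:\mathfrak{h}\to\wedge^2\mathfrak{h}^*$, $\Delta(\Omega)(X,Y)=\mathrm{ad}_X^*\Omega(Y)-\mathrm{ad}_Y^*\Omega(X)-\Omega([X,Y]_{\mathfrak{h}})$; $\Omega$ is a 1-cocycle if $\Delta(\Omega)=0$. ''Non-vanishing products'' means all products of elements of the summands not listed are zero.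 The algebra obtained from an $\mathrm{L}$-quadratic left Leibniz algebra $(A,\bullet_A,\langle\;,\;\rangle_A)$ and a Lie algebra $(\mathfrak{h},[\;,\;]_{\mathfrak{h}})$ by means of $(F,G,\omega,\theta,\Omega)$: here $F:\mathfrak{h}\to\mathrm{so}(A)\cap\mathrm{Der}(A)$, $G:\mathfrak{h}\to\mathrm{End}(A)$, $\Omega:\mathfrak{h}\to\wedge^2\mathfrak{h}^*$ are linear, $\theta,\omega:\mathfrak{h}\times\mathfrak{h}\to A$ bilinear with $\omega$ skew-symmetric, satisfying for all $X,Y,Z,T\in\mathfrak{h}$, $a\in A$: $$\begin{cases} [\mathrm{L}^A_a,F(X)]=\mathrm{L}^A_{G(X)a},\quad [\mathrm{L}^A_a,G(X)]=\mathrm{R}^A_{G(X)a},\\ \mathrm{R}^A_{\omega(X,Y)}=G(Y)^*G(X)-G(X)^*G(Y),\\ \mathrm{R}^A_{\theta(X,Y)}=[F(X),G(Y)]-G([X,Y]_{\mathfrak{h}})=F(X)G(Y)+G(Y)G(X)-G([X,Y]_{\mathfrak{h}}),\\ \mathrm{L}^A_{\theta(X,Y)}=[F(X),F(Y)]-F([X,Y]_{\mathfrak{h}}),\\ \theta(X,[Y,Z]_{\mathfrak{h}})-\theta([X,Y]_{\mathfrak{h}},Z)-\theta(Y,[X,Z]_{\mathfrak{h}})+F(X)\theta(Y,Z)-F(Y)\theta(X,Z)-G(Z)\theta(X,Y)=0,\\ G(Z)^*\theta(X,Y)-G(Y)^*\theta(X,Z)-F(X)\omega(Y,Z)+\omega(Y,[X,Z]_{\mathfrak{h}})+\omega([X,Y]_{\mathfrak{h}},Z)=0,\\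 (G(X)^*-F(X))\omega(Y,Z)=0,\\ \Delta(\Omega)(X,Y)(Z,T)=\langle\theta(X,T),\theta(Y,Z)\rangle_A-\langle\theta(Y,T),\theta(X,Z)\rangle_A-\langle\omega(Z,T),\theta(X,Y)\rangle_A, \end{cases}$$ and the non-vanishing products on $\mathfrak{h}\oplus A\oplus\mathfrak{h}^*$ are $X\bullet Y=[X,Y]_{\mathfrak{h}}+\theta(X,Y)+\Omega(X)^\flat(Y)$, $a\bullet b=a\bullet_A b+\mu(a,b)$, $X\bullet a=F(X)a+\nu(X,a)$, $X\bullet\alpha=(\mathrm{ad}^{\mathfrak{h}}_X)^*\alpha$, $a\bullet X=G(X)a+\rho(a,X)$, where $\rho(a,X)(Y)=-\langle\omega(X,Y),a\rangle_A$, $\mu(a,b)(X)=-\langle G(X)a,b\rangle_A$, $\nu(X,a)(Y)=-\langle\theta(X,Y),a\rangle_A$. The result, with the metric $\langle\;,\;\rangle_n$, is an $\mathrm{L}$-quadratic left Leibniz algebra. *)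

(* Defs.v *)
From HB Require Import structures.
From mathcomp Require Import all_boot all_order all_algebra reals.

Set Implicit Arguments.
Unset Strict Implicit.
Unset Printing Implicit Defensive.

Import GRing.Theory.
Local Open Scope ring_scope.

(** Finite-dimensional real spaces are [vectType R] with [R : realType], and
    bilinear maps [U x U -> V] are curried as elements of ['Hom(U, 'Hom(U, V))].
    In particular, for a product [m : 'Hom(A, 'End(A))], the operator [m a] is
    the left multiplication [L_a]; a bilinear form [s] on [h] is its own flat
    map, since [s X] is the linear form [Y |-> s(X, Y)]. *)

Section Algebras.
Context {R : realType}.
Implicit Types U V W A : vectType R.

Definition skew2 U V (b : 'Hom(U, 'Hom(U, V))) : Prop :=
  forall x y, b x y = - b y x.

Definition left_leibniz A (m : 'Hom(A, 'End(A))) : Prop :=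
  forall u v w, m u (m v w) = m (m u v) w + m v (m u w).

Definition lie_algebra A (m : 'Hom(A, 'End(A))) : Prop :=
  (forall x, m x x = 0) /\
  (forall x y z, m x (m y z) + m y (m z x) + m z (m x y) = 0).

Definition is_metric A (g : 'Hom(A, 'Hom(A, R^o))) : Prop :=
  (forall x y, g x y = g y x) /\
  (forall x, (forall y, g x y = 0) -> x = 0).

(** Membership in [so(A)] and in [Der(A)]. *)
Definition skew_endo A (g : 'Hom(A, 'Hom(A, R^o))) (f : 'End(A)) : Prop :=
  forall x y, g (f x) y = - g x (f y).

Definition derivation A (m : 'Hom(A, 'End(A))) (f : 'End(A)) : Prop :=
  forall x y, f (m x y) = m (f x) y + m x (f y).

Definition L_quadratic A (m : 'Hom(A, 'End(A)))
    (g : 'Hom(A, 'Hom(A, R^o))) : Prop :=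
  is_metric g /\ (forall a, skew_endo g (m a)).

Definition center A (m : 'Hom(A, 'End(A))) (z : A) : Prop :=
  forall x, m z x = 0 /\ m x z = 0.

Definition trivial_center A (m : 'Hom(A, 'End(A))) : Prop :=
  forall z, center m z -> z = 0.

(** Chevalley-Eilenberg cocycles and coboundaries in degree 2, with trivial
    real coefficients. *)
Definition cocycle2 A (m : 'Hom(A, 'End(A)))
    (c : 'Hom(A, 'Hom(A, R^o))) : Prop :=
  skew2 c /\
  (forall x y z, - c (m x y) z + c (m x z) y - c (m y z) x = 0).

Definition coboundary2 A (m : 'Hom(A, 'End(A)))
    (c : 'Hom(A, 'Hom(A, R^o))) : Prop :=
  exists f : 'Hom(A, R^o), forall x y, c x y = - f (m x y).

Definition H2_trivial A (m : 'Hom(A, 'End(A))) : Prop :=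
  forall c, cocycle2 m c -> coboundary2 m c.

Definition isomorphic V W
    (mV : V -> V -> V) (gV : V -> V -> R)
    (mW : W -> W -> W) (gW : W -> W -> R) : Prop :=
  exists f : 'Hom(V, W),
    [/\ bijective f,
        forall x y, f (mV x y) = mW (f x) (f y) &
        forall x y, gW (f x) (f y) = gV x y].

Definition commutator A (f k : 'End(A)) : 'End(A) :=
  (f \o k)%VF - (k \o f)%VF.

Definition Rmul A (m : 'Hom(A, 'End(A))) (a : A) : 'End(A) :=
  linfun (fun b => m b a).

Lemma RmulE A (m : 'Hom(A, 'End(A))) a b : Rmul m a b = m b a.
Proof.
have lin : linear (fun b => m b a).
  by move=> k x y; rewrite linearP add_lfunE scale_lfunE.
pose M := GRing.isLinear.Build _ _ _ _ (fun b => m b a) lin.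
pose f : {linear A -> A} := HB.pack (fun b => m b a) M.
exact: (lfunE f).
Qed.

(** Adjoint with respect to a metric [g], seen as the isomorphism
    [A -> A^*]: [adj g f y] is the vector representing [x |-> <y, f x>]; it has
    its meaning when [g] is nondegenerate, see [adjP]. *)
Definition adj A (g : 'Hom(A, 'Hom(A, R^o))) (f : 'End(A)) : 'End(A) :=
  linfun (fun y => (g^-1)%VF (g y \o f)%VF).

Lemma adjP A (g : 'Hom(A, 'Hom(A, R^o))) (f : 'End(A)) : is_metric g ->
  forall x y, g (f x) y = g x (adj g f y).
Proof.
move=> [gC g0] x y.
have lin : linear (fun y => (g^-1)%VF (g y \o f)%VF).
  by move=> k u v; rewrite linearP comp_lfunDl -comp_lfunZl linearP.
pose M := GRing.isLinear.Build _ _ _ _ _ lin.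
pose F : {linear A -> A} := HB.pack (fun y => (g^-1)%VF (g y \o f)%VF) M.
have -> : adj g f y = (g^-1)%VF (g y \o f)%VF by exact: (lfunE F).
have kg : lker g == 0%VS.
  apply/lker0P => u v e; apply/eqP; rewrite -subr_eq0; apply/eqP/g0 => w.
  by rewrite linearB /= e subrr lfunE.
have im : limg g = fullv.
  apply/eqP; rewrite eqEdim subvf /= limg_dim_eq ?(eqP kg) ?capv0 //.
  by rewrite !dimvf /dim /= muln1.
rewrite [RHS]gC limg_lfunVK ?im ?memvf //.
by rewrite comp_lfunE gC.
Qed.

End Algebras.

Section Construction.
Context {R : realType} {h A : vectType R}.
Variables (br : 'Hom(h, 'End(h))) (m : 'Hom(A, 'End(A))).
Variable g : 'Hom(A, 'Hom(A, R^o)).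

Definition coad (X : h) (alpha : 'Hom(h, R^o)) : 'Hom(h, R^o) :=
  - (alpha \o br X)%VF.

Definition coad2 (X : h) (sigma : 'Hom(h, 'Hom(h, R^o))) (Y Z : h) : R :=
  - sigma (br X Y) Z - sigma Y (br X Z).

Definition Delta (Omega : 'Hom(h, 'Hom(h, 'Hom(h, R^o)))) (X Y Z T : h) : R :=
  coad2 X (Omega Y) Z T - coad2 Y (Omega X) Z T - Omega (br X Y) Z T.

(** Linear maps from [h] to the second exterior power of [h^*], identified with
    the space of skew-symmetric bilinear forms on [h]. *)
Definition wedge2_valued (Omega : 'Hom(h, 'Hom(h, 'Hom(h, R^o)))) : Prop :=
  forall X, skew2 (Omega X).

Definition cocycle1 (Omega : 'Hom(h, 'Hom(h, 'Hom(h, R^o)))) : Prop :=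
  wedge2_valued Omega /\ (forall X Y Z T, Delta Omega X Y Z T = 0).

Variables (F G : 'Hom(h, 'End(A))) (omega theta : 'Hom(h, 'Hom(h, A))).
Variable Omega : 'Hom(h, 'Hom(h, 'Hom(h, R^o))).

Record admissible : Prop := Admissible {
  adm_F_so : forall X, skew_endo g (F X);
  adm_F_der : forall X, derivation m (F X);
  adm_omega : skew2 omega;
  adm_Omega : wedge2_valued Omega;
  adm_LF : forall X a, commutator (m a) (F X) = m (G X a);
  adm_LG : forall X a, commutator (m a) (G X) = Rmul m (G X a);
  adm_Romega : forall X Y,
    Rmul m (omega X Y) = (adj g (G Y) \o G X)%VF - (adj g (G X) \o G Y)%VF;
  adm_Rtheta1 : forall X Y,
    Rmul m (theta X Y) = commutator (F X) (G Y) - G (br X Y);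
  adm_Rtheta2 : forall X Y,
    Rmul m (theta X Y) = (F X \o G Y)%VF + (G Y \o G X)%VF - G (br X Y);
  adm_Ltheta : forall X Y,
    m (theta X Y) = commutator (F X) (F Y) - F (br X Y);
  adm_theta : forall X Y Z,
    theta X (br Y Z) - theta (br X Y) Z - theta Y (br X Z)
      + F X (theta Y Z) - F Y (theta X Z) - G Z (theta X Y) = 0;
  adm_theta_omega : forall X Y Z,
    adj g (G Z) (theta X Y) - adj g (G Y) (theta X Z) - F X (omega Y Z)
      + omega Y (br X Z) + omega (br X Y) Z = 0;
  adm_GF_omega : forall X Y Z, (adj g (G X) - F X) (omega Y Z) = 0;
  adm_Delta : forall X Y Z T,
    Delta Omega X Y Z T = g (theta X T) (theta Y Z) - g (theta Y T) (theta X Z)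
                          - g (omega Z T) (theta X Y)
}.

Definition rho (a : A) (X : h) : 'Hom(h, R^o) :=
  linfun (fun Y => - g (omega X Y) a).
Definition mu (a b : A) : 'Hom(h, R^o) :=
  linfun (fun X => - g (G X a) b).
Definition nu (X : h) (a : A) : 'Hom(h, R^o) :=
  linfun (fun Y => - g (theta X Y) a).

(** The space [h (+) A (+) h^*] is [h * A * 'Hom(h, R^o)]. *)
Notation total := (h * A * 'Hom(h, R^o))%type.

Definition ext_mul (x y : total) : total :=
  let: (X, a, _) := x in
  let: (Y, b, beta) := y in
  (br X Y,
   theta X Y + m a b + F X b + G Y a,
   Omega X Y + mu a b + nu X b + coad X beta + rho a Y).

(** Polar form of [X + a + alpha |-> 2 alpha(X) + <a, a>]. *)
Definition ext_metric (x y : total) : R :=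
  let: (X, a, alpha) := x in
  let: (Y, b, beta) := y in
  alpha Y + beta X + g a b.

Definition Ustar (U : 'Hom(h, A)) (a : A) : 'Hom(h, R^o) := (g a \o U)%VF.

Definition circ_mul (Omega0 : 'Hom(h, 'Hom(h, 'Hom(h, R^o)))) (U : 'Hom(h, A))
    (x y : total) : total :=
  let: (X, a, _) := x in
  let: (Y, b, beta) := y in
  (br X Y, m a b, Omega0 X Y + Ustar U (m a b) + coad X beta).

Definition circ_metric (U : 'Hom(h, A)) (x y : total) : R :=
  let: (X, a, _) := x in
  let: (Y, b, _) := y in
  ext_metric x y + g (U X) (U Y) - g a (U Y) - g b (U X).

Lemma linfun_formE (k : 'Hom(h, A)) (a : A) (Y : h) :
  linfun (fun Y => - g (k Y) a : R^o) Y = - g (k Y) a.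
Proof.
have lin : linear (fun Y => - g (k Y) a : R^o).
  by move=> c x y; rewrite !linearP add_lfunE scale_lfunE opprD scalerN.
pose M := GRing.isLinear.Build _ _ _ _ _ lin.
pose f : {linear h -> R^o} := HB.pack (fun Y => - g (k Y) a : R^o) M.
exact: (lfunE f).
Qed.

Lemma rhoE a X Y : rho a X Y = - g (omega X Y) a.
Proof. exact: linfun_formE. Qed.

Lemma nuE X a Y : nu X a Y = - g (theta X Y) a.
Proof. exact: linfun_formE. Qed.

Lemma muE a b X : mu a b X = - g (G X a) b.
Proof.
have lin : linear (fun X => - g (G X a) b : R^o).
  move=> c x y.
  by rewrite linearP add_lfunE scale_lfunE linearP add_lfunE scale_lfunE
             opprD scalerN.
pose M := GRing.isLinear.Build _ _ _ _ _ lin.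
pose f : {linear h -> R^o} := HB.pack (fun X => - g (G X a) b : R^o) M.
exact: (lfunE f).
Qed.

End Construction.

(* Main.v *)
From HB Require Import structures.
Require Import Defs.
From mathcomp Require Import all_boot all_order all_algebra reals.
From mathcomp Require Import lra.

Set Implicit Arguments.
Unset Strict Implicit.
Unset Printing Implicit Defensive.

Import GRing.Theory.
Local Open Scope ring_scope.

(** Everything in the extension that mixes [h] with [A] is inner, and a single
    orthogonal transformation undoes it.

    On a Lie algebra [A] with an invariant metric, a skew-symmetric derivation
    [D] is the same thing as a 2-cocycle [<D x, y>]; a primitive of this cocycle
    is a linear form, hence [<v, .>] for some [v], and [D] is then [- ad v]. So
    [H^2(A) = 0] makes every [F X] inner ([skew_derivation_inner]), and
    [Z(A) = 0] makes its generator unique, thus linear in [X]: [F X = ad (V X)]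
    ([inner_lift]). As [ad] is injective, the compatibility conditions then
    determine the remaining data by comparing adjoint operators:
    [G X = - ad (V X)], [omega(X, Y) = - [V X, V Y]] and
    [theta(X, Y) = [V X, V Y] - V [X, Y]].

    Let [V^* : A -> h^*] be the transpose [<a, V .>]. The endomorphism
    [N = V - V^*] of [h + A + h^*] is skew-symmetric for the neutral metric and
    [N^3 = 0], so [exp N = 1 + N + N^2 / 2] is an isometry, with inverse
    [exp (- N)]: this is [transvection]. It sends [X] to [X + V X + ...], which
    in an orthogonal sum with [A] acts on [A] as [ad (V X)], just as [X] does in
    the extension; the term [- V^*] removes [mu], [nu] and [rho], and what is
    left of the cross terms goes into the [h^*]-component of the product of two
    elements of [h]. That component is the form [Omega0] of [is_reduced], and
    the algebra becomes the orthogonal sum of [A] with an extension of [h] by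
    [h^*] ([transvection_morphism]). The twisting map [U] can therefore be taken
    to be zero.

    That [Omega0] is a 1-cocycle ([reduced_cocycle1]) is where the prescribed
    value of [Delta(Omega)] enters. Expanded in [V], its quartic terms cancel by
    the Jacobi identity of [A]; its cubic and quadratic terms are those of
    [- Delta(Omega0 - Omega)], by invariance of the metric and by the Jacobi
    identity of [h]. *)

(** * Linear and bilinear maps *)

Section LinearAlgebra.
Context {R : realType}.
Implicit Types U V W : vectType R.

(** Stated with an informative existential, so that [bilinear_hom] can apply it
    uniformly in a parameter. *)
Lemma linear_hom U V (f : U -> V) : linear f ->
  {F : 'Hom(U, V) | forall x, F x = f x}.
Proof.
move=> lin; pose M := GRing.isLinear.Build _ _ _ _ f lin.
pose F : {linear U -> V} := HB.pack f M.
by exists (linfun F) => x; exact: (lfunE F).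
Qed.

Lemma bilinear_hom U V W (b : U -> V -> W) :
  (forall x, linear (b x)) -> (forall y, linear (b^~ y)) ->
  {B : 'Hom(U, 'Hom(V, W)) | forall x y, B x y = b x y}.
Proof.
move=> linr linl.
have [|B BE] := @linear_hom _ _ (fun x => sval (linear_hom (linr x))).
  move=> k x y; apply/lfunP => z; rewrite add_lfunE scale_lfunE.
  by rewrite (svalP (linear_hom (linr _))) linl -!(svalP (linear_hom (linr _))).
by exists B => x y; rewrite BE (svalP (linear_hom (linr x))).
Qed.

Lemma bilinear_comp U U' V V' W W' (b : 'Hom(U, 'Hom(V, W)))
  (f : 'Hom(U', U)) (k : 'Hom(V', V)) (l : 'Hom(W, W')) :
  {B : 'Hom(U', 'Hom(V', W')) | forall x y, B x y = l (b (f x) (k y))}.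
Proof.
apply: bilinear_hom => [x|y] c u v; first by rewrite !linearP.
by rewrite (linearP f) (linearP b) add_lfunE scale_lfunE linearP.
Qed.

(** The additivity rules are restated for ['Hom], with [hom2*] for the first
    argument of a curried bilinear map: rewriting with the generic morphism
    lemmas does not always find the nested instances. *)
Lemma homD U V (f : 'Hom(U, V)) x y : f (x + y) = f x + f y.
Proof. exact: linearD. Qed.

Lemma homN U V (f : 'Hom(U, V)) x : f (- x) = - f x.
Proof. exact: linearN. Qed.

Lemma homZ U V (f : 'Hom(U, V)) k x : f (k *: x) = k *: f x.
Proof. exact: linearZ. Qed.

Lemma hom2D U V W (b : 'Hom(U, 'Hom(V, W))) x y z :
  b (x + y) z = b x z + b y z.
Proof. by rewrite linearD add_lfunE. Qed.

Lemma hom2N U V W (b : 'Hom(U, 'Hom(V, W))) x z : b (- x) z = - b x z.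
Proof. by rewrite linearN opp_lfunE. Qed.

Lemma hom2Z U V W (b : 'Hom(U, 'Hom(V, W))) k x z :
  b (k *: x) z = k *: b x z.
Proof. by rewrite linearZ scale_lfunE. Qed.

Lemma hom2_combE U V W (b1 b2 b3 b4 : 'Hom(U, 'Hom(V, W))) k x y :
  (b1 - b2 + k *: (b3 + b4)) x y = b1 x y - b2 x y + k *: (b3 x y + b4 x y).
Proof. by rewrite !(add_lfunE, opp_lfunE, scale_lfunE). Qed.

Definition homE := (hom2D, hom2N, hom2Z, homD, homN, homZ).

Lemma metric_represents V (g : 'Hom(V, 'Hom(V, R^o))) (f : 'Hom(V, R^o)) :
  is_metric g -> exists v, g v = f.
Proof.
move=> [_ g0]; exists ((g^-1)%VF f); apply: limg_lfunVK.
have kg : lker g == 0%VS.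
  apply/lker0P => u v e; apply/eqP; rewrite -subr_eq0; apply/eqP/g0 => w.
  by rewrite linearB /= e subrr lfunE.
suff -> : limg g = fullv by apply: memvf.
apply/eqP; rewrite eqEdim subvf /= limg_dim_eq ?(eqP kg) ?capv0 //.
by rewrite !dimvf /dim /= muln1.
Qed.

Lemma metric_inj V (g : 'Hom(V, 'Hom(V, R^o))) x y :
  is_metric g -> (forall z, g x z = g y z) -> x = y.
Proof.
move=> [_ g0] e; apply/eqP; rewrite -subr_eq0; apply/eqP/g0 => z.
by rewrite !homE e subrr.
Qed.

End LinearAlgebra.

(** * Quadratic Lie algebras *)

Section QuadraticLie.
Context {R : realType} {A : vectType R}.
Variables (m : 'Hom(A, 'End(A))) (g : 'Hom(A, 'Hom(A, R^o))).

Lemma lie_skew : lie_algebra m -> skew2 m.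
Proof.
move=> [alt _] x y; apply/eqP; rewrite -addr_eq0; apply/eqP.
by move: (alt (x + y)); rewrite !homE !alt add0r addr0 addrC.
Qed.

Lemma lie_left_leibniz : lie_algebra m -> left_leibniz m.
Proof.
move=> lie x y z; have sk := lie_skew lie; case: lie => _ jac.
have := jac x y z; rewrite (sk z (m x y)) (sk z x) linearN /=.
by move=> /eqP; rewrite subr_eq0 => /eqP <-; rewrite subrK.
Qed.

Lemma ad_inj : lie_algebra m -> trivial_center m -> injective m.
Proof.
move=> /lie_skew sk z0 x y e; apply/eqP; rewrite -subr_eq0; apply/eqP/z0 => w.
have e0 : m (x - y) w = 0 by rewrite !homE e subrr.
by split=> //; rewrite sk e0 oppr0.
Qed.

Hypotheses (lie : lie_algebra m) (quad : L_quadratic m g).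

Lemma triple_skewl x y z : g (m x y) z = - g (m y x) z.
Proof. by rewrite (lie_skew lie x) !homE. Qed.

Lemma triple_skewr x y z : g (m x y) z = - g (m x z) y.
Proof. by have [[gC _] inv] := quad; rewrite inv gC. Qed.

(** By invariance the left-hand side is [<x, J>], where [J] is the Jacobi sum of
    [t], [y] and [z]. *)
Lemma metric_jacobi x y z t :
  g (m x t) (m y z) - g (m y t) (m x z) + g (m z t) (m x y) = 0.
Proof.
have [[gC _] inv] := quad.
have move_left u w : g (m x u) w = g x (m u w).
  by rewrite triple_skewl inv opprK.
rewrite [g (m y t) _]gC [g (m z t) _]gC !move_left.
rewrite -(homN (g x)) -!(homD (g x)) -(homN (m z)) -(lie_skew lie t y) addrAC.
by have [_ ->] := lie; rewrite linear0.
Qed.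

(** The form [<D x, y>] is skew because [D] is, and closed because [D] is a
    derivation and [<[x, y], z>] is totally skew. If [<v, .>] is the linear form
    of which it is the coboundary, then [<D x, y> = - <v, [x, y]>] is
    [<[- v, x], y>]. *)
Lemma skew_derivation_inner (D : 'End(A)) :
  H2_trivial m -> skew_endo g D -> derivation m D -> exists v, m v = D.
Proof.
have [met inv] := quad; have [gC g0] := met.
move=> h2 skD derD; have [] := h2 (g \o D)%VF.
  split=> [x y|x y z]; first by rewrite !comp_lfunE skD gC.
  rewrite !comp_lfunE !skD [g (m x z) _]triple_skewr [g (m y z) _]triple_skewr.
  rewrite [g (m y _) z]triple_skewl !opprK -[g (m x y) _]opprK -skD derD !homE.
  by rewrite -addrA (addrC (g _ z)) addNr.
move=> f fE; have [v gv] := metric_represents f met.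
exists (- v); apply/lfunP => x; apply: (metric_inj met) => y.
have := fE x y; rewrite comp_lfunE -gv => ->.
by rewrite !homE triple_skewl inv opprK.
Qed.

(** Linearity of the lift comes for free: on the image of the injective map
    [ad], the linear map [m^-1] is its inverse. *)
Lemma inner_lift (h : vectType R) (F : 'Hom(h, 'End(A))) :
  trivial_center m -> (forall X, exists v, m v = F X) ->
  exists V : 'Hom(h, A), forall X, m (V X) = F X.
Proof.
move=> z0 inn; exists (m^-1 \o F)%VF => X; rewrite comp_lfunE.
by apply: limg_lfunVK; have [v <-] := inn X; apply: memv_img; apply: memvf.
Qed.

End QuadraticLie.

(** * The orthogonal transvection of a linear map from h to A *)

Section Transvection.
Context {R : realType} {h A : vectType R}.
Variable g : 'Hom(A, 'Hom(A, R^o)).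

Lemma UstarD (U : 'Hom(h, A)) a b :
  Ustar g U (a + b) = Ustar g U a + Ustar g U b.
Proof. by rewrite /Ustar homD comp_lfunDl. Qed.

Lemma UstarN (U : 'Hom(h, A)) a : Ustar g U (- a) = - Ustar g U a.
Proof. by rewrite /Ustar homN comp_lfunNl. Qed.

Lemma Ustar_hom (U : 'Hom(h, A)) :
  {S : 'Hom(A, 'Hom(h, R^o)) | forall a, S a = Ustar g U a}.
Proof.
by apply: linear_hom => k a b; rewrite /Ustar linearP comp_lfunDl -comp_lfunZl.
Qed.

(** The exponential of [N = V - V^*]; the last term is [N^2 / 2]. *)
Definition transvection (V : 'Hom(h, A)) (x : h * A * 'Hom(h, R^o)) :
    h * A * 'Hom(h, R^o) :=
  let: (X, a, alpha) := x in
  (X, a + V X, alpha - Ustar g V a - 2^-1 *: Ustar g V (V X)).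

(** [exp (- N)] is the inverse of [exp N]. *)
Lemma transvectionK (W : 'Hom(h, A)) :
  cancel (transvection W) (transvection (- W)).
Proof.
move=> [[X a] alpha]; rewrite /transvection /Ustar opp_lfunE addrK.
congr (_, _, _).
rewrite linearN linearD /= !comp_lfunNr !comp_lfunNl comp_lfunDl !opprK.
move: (_ \o W)%VF => u; move: (_ \o W)%VF => v.
rewrite {2}(_ : v = 2^-1 *: v + 2^-1 *: v); last first.
  by rewrite -scalerDl (_ : _ + _ = 1) ?scale1r; last by lra.
by rewrite (addrA u) (addrA (_ - _ - _)) -(addrA alpha) -opprD subrK addrK.
Qed.

Lemma transvection_linear (W : 'Hom(h, A)) : linear (transvection W).
Proof.
have [S SE] := Ustar_hom W.
have opprD_ACA (x y z t : 'Hom(h, R^o)) : x + y - (z + t) = (x - z) + (y - t).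
  by rewrite opprD addrACA.
move=> k [[X a] alpha] [[Y b] beta]; rewrite /transvection /= -!SE.
congr (_, _, _); first by rewrite homD homZ addrACA -scalerDr.
rewrite !homD !homZ [2^-1 *: (_ + _)]scalerDr.
rewrite [2^-1 *: (k *: _)]scalerA mulrC -scalerA.
by rewrite [X in X - _]opprD_ACA -scalerBr opprD_ACA -scalerBr.
Qed.

Lemma transvection_isometry (W : 'Hom(h, A)) x y : is_metric g ->
  ext_metric g (transvection W x) (transvection W y) = ext_metric g x y.
Proof.
move=> [gC _]; case: x => [[X a] alpha]; case: y => [[Y b] beta].
rewrite /ext_metric /transvection /Ustar.
rewrite !(add_lfunE, opp_lfunE) !scale_lfunE !comp_lfunE !homE.
rewrite (gC b) (gC (W Y)).
have cancel_halves (p q r s t u : R) : p - s - 2^-1 * u + (q - t - 2^-1 * u)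
  + (r + s + (t + u)) = p + q + r by lra.
exact: cancel_halves.
Qed.

Lemma circ_metric0 x y : circ_metric g (0 : 'Hom(h, A)) x y = ext_metric g x y.
Proof.
case: x => [[X a] alpha]; case: y => [[Y b] beta].
have zE Z : (0 : 'Hom(h, A)) Z = 0 by exact: zero_lfunE.
have gE c : g c 0 = 0 by exact: linear0.
by rewrite /circ_metric !zE !gE addr0 !subr0.
Qed.

End Transvection.

(** * Reduction of the extension *)

Section Reduction.
Context {R : realType} {h A : vectType R}.
Variables (br : 'Hom(h, 'End(h))) (m : 'Hom(A, 'End(A))).
Variable g : 'Hom(A, 'Hom(A, R^o)).
Variables (F G : 'Hom(h, 'End(A))) (omega theta : 'Hom(h, 'Hom(h, A))).
Variable Omega : 'Hom(h, 'Hom(h, 'Hom(h, R^o))).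

Lemma coadB X beta gamma :
  coad br X (beta - gamma) = coad br X beta - coad br X gamma.
Proof. by rewrite /coad comp_lfunDl comp_lfunNl opprD. Qed.

Lemma coadZ X k beta : coad br X (k *: beta) = k *: coad br X beta.
Proof. by rewrite /coad -comp_lfunZl scalerN. Qed.

Lemma coad_hom :
  {C : 'Hom(h, 'End('Hom(h, R^o))) |
    forall X alpha, C X alpha = coad br X alpha}.
Proof.
apply: bilinear_hom => [X|alpha] k P Q.
  by rewrite /coad comp_lfunDl -comp_lfunZl opprD scalerN.
by rewrite /coad linearP comp_lfunDr -comp_lfunZr opprD scalerN.
Qed.

Variable V : 'Hom(h, A).

(** The equation that [Omega0] has to satisfy for [transvection g V] to be
    multiplicative on pairs in [h]. As a trilinear form, [Omega0] is
    [Omega(X)(Y, Z) - <[VX, VY], VZ> + (<V[X, Y], VZ> - <VY, V[X, Z]>) / 2]. *)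
Definition is_reduced (Omega0 : 'Hom(h, 'Hom(h, 'Hom(h, R^o)))) : Prop :=
  forall X Y, Omega0 X Y = Omega X Y - Ustar g V (m (V X) (V Y))
      + 2^-1 *: (Ustar g V (V (br X Y)) + coad br X (Ustar g V (V Y))).

Lemma reduced_exists : {Omega0 | is_reduced Omega0}.
Proof.
have [S SE] := Ustar_hom g V; have [C CE] := coad_hom.
have [B1 B1E] := bilinear_comp m V V S.
have [B2 B2E] := bilinear_comp br \1%VF \1%VF (S \o V)%VF.
have [B3 B3E] := bilinear_comp C \1%VF (S \o V)%VF \1%VF.
exists (Omega - B1 + 2^-1 *: (B2 + B3)) => X Y.
rewrite hom2_combE B1E B2E B3E CE.
by do ![rewrite comp_lfunE | rewrite id_lfunE | rewrite SE].
Qed.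

Hypotheses (lie_h : lie_algebra br) (lie_A : lie_algebra m).
Hypotheses (quad : L_quadratic m g) (Z0 : trivial_center m).
Hypothesis adm : admissible br m g F G omega theta Omega.
Hypothesis FV : forall X, m (V X) = F X.

Let met : is_metric g := quad.1.

Lemma inner_F X a : F X a = m (V X) a.
Proof. by rewrite FV. Qed.

(** Since [F X] is a derivation, [[L_a, F X] = L_(- F(X) a)], and the same
    commutator is [L_(G(X) a)]. *)
Lemma inner_G X a : G X a = - m (V X) a.
Proof.
apply: (ad_inj lie_A Z0); rewrite -(adm_LF adm).
apply/lfunP => b; rewrite /commutator add_lfunE opp_lfunE !comp_lfunE.
rewrite (adm_F_der adm) opprD addrCA subrr addr0.
by rewrite homN opp_lfunE FV.
Qed.

Lemma inner_adjG X a : adj g (G X) a = m (V X) a.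
Proof.
apply: (metric_inj met) => b; have [gC _] := met; have [_ inv] := quad.
by rewrite gC -adjP // inner_G !homE inv opprK gC.
Qed.

Lemma inner_omega X Y : omega X Y = - m (V X) (V Y).
Proof.
apply: (ad_inj lie_A Z0); apply/lfunP => a.
have := congr1 (fun f : 'End(A) => f a) (adm_Romega adm X Y).
rewrite RmulE add_lfunE opp_lfunE !comp_lfunE !inner_adjG !inner_G.
rewrite (lie_skew lie_A a) !linearN /= opprK => /eqP.
rewrite eqr_oppLR => /eqP ->; rewrite opp_lfunE opprD opprK.
by rewrite (lie_left_leibniz lie_A (V X)) opprD addrCA subrr addr0.
Qed.

Lemma inner_theta X Y : theta X Y = m (V X) (V Y) - V (br X Y).
Proof.
apply: (ad_inj lie_A Z0); rewrite (adm_Ltheta adm) linearB /= -(FV (br X Y)).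
congr (_ - _); apply/lfunP => a.
rewrite /commutator add_lfunE opp_lfunE !comp_lfunE -!FV.
by rewrite (lie_left_leibniz lie_A (V X)) addrK.
Qed.

(** The [h^*]-valued maps [mu], [nu] and [rho] are, up to the coadjoint
    action, images under [V^*] of brackets in [A]: this is what the term [- V^*]
    of the transvection absorbs. *)
Lemma inner_mu a b : mu g G a b = Ustar g V (m a b).
Proof.
apply/lfunP => Z; rewrite muE inner_G !homE opprK comp_lfunE.
by rewrite [LHS](triple_skewl g lie_A) [RHS](triple_skewr quad).
Qed.

Lemma inner_nu X b :
  nu g theta X b = Ustar g V (m (V X) b) - coad br X (Ustar g V b).
Proof.
have [gC _] := met.
apply/lfunP => Z; rewrite nuE inner_theta !homE opprD opprK /coad opprK.
by rewrite add_lfunE !comp_lfunE (gC b) [in RHS](triple_skewr quad).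
Qed.

Lemma inner_rho a Y : rho g omega a Y = - Ustar g V (m (V Y) a).
Proof.
apply/lfunP => Z; rewrite rhoE inner_omega !homE opprK opp_lfunE comp_lfunE.
by rewrite [LHS](triple_skewr quad).
Qed.

Lemma reduced_cocycle1 Omega0 : is_reduced Omega0 -> cocycle1 br Omega0.
Proof.
move=> Omega0E; have [gC _] := met.
pose O X Y Z : R := Omega X Y Z.
pose K X Y Z : R := g (m (V X) (V Y)) (V Z).
pose B X Y : R := g (V X) (V Y).
pose Q X Y Z T : R := g (m (V X) (V Y)) (m (V Z) (V T)).
have E X Y Z : Omega0 X Y Z =
    O X Y Z - K X Y Z + 2^-1 * (B (br X Y) Z - B Y (br X Z)) :> R.
  rewrite Omega0E /coad /Ustar add_lfunE add_lfunE opp_lfunE scale_lfunE.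
  by rewrite add_lfunE opp_lfunE !comp_lfunE.
have BC X Y : B X Y = B Y X by apply: gC.
have K12 X Y Z : K X Y Z = - K Y X Z by rewrite /K triple_skewl.
have K23 X Y Z : K X Y Z = - K X Z Y by rewrite /K (triple_skewr quad).
split=> [X Y Z|X Y Z T].
  rewrite !E; have OC : O X Y Z = - O X Z Y by apply: (adm_Omega adm).
  have := K23 X Y Z; have := BC (br X Y) Z; have := BC Y (br X Z).
  move: OC; clearbody O K B; lra.
have D := adm_Delta adm X Y Z T; move: D.
rewrite /Delta /coad2 !E !inner_theta !inner_omega.
have thth P P' P'' P''' : g (m (V P) (V P') - V (br P P'))
     (m (V P'') (V P''') - V (br P'' P''')) =
   Q P P' P'' P''' - K P P' (br P'' P''') - K P'' P''' (br P P')
   + B (br P P') (br P'' P''') :> R.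
  by rewrite !homE opprD opprK (gC (V (br P P')) (m _ _)) addrA.
rewrite !thth.
have -> : g (- m (V Z) (V T)) (m (V X) (V Y) - V (br X Y))
   = - Q Z T X Y + K Z T (br X Y) :> R.
  by rewrite !homE opprD opprK.
have QJ : Q X T Y Z - Q Y T X Z + Q Z T X Y = 0 by apply: metric_jacobi.
have BJ P P' :
    B (br X (br Y P)) P' = B (br (br X Y) P) P' + B (br Y (br X P)) P'.
  by rewrite /B (lie_left_leibniz lie_h) !homE.
(* Put every term into a normal form in which only [QJ], [BJ] and the symmetry
   of [B] remain to be used, linearly. *)
rewrite (K23 Y (br X Z)) (K23 X (br Y Z)) (K12 (br X Y)) (K23 Z (br X Y)).
rewrite !(BC Z); move: QJ (BC (br X Z) (br Y T)) (BC (br Y Z) (br X T)).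
move: (BJ Z T) (BJ T Z); rewrite /O; clearbody K B Q; lra.
Qed.

Lemma transvection_morphism Omega0 x y : is_reduced Omega0 ->
  transvection g V (ext_mul br m g F G omega theta Omega x y) =
  circ_mul br m g Omega0 0 (transvection g V x) (transvection g V y).
Proof.
move=> Omega0E; case: x => [[X a] alpha]; case: y => [[Y b] beta].
rewrite /transvection /circ_mul; congr (_, _, _).
  rewrite inner_F inner_G inner_theta !homE [m a (V Y)](lie_skew lie_A).
  have regroup (p q r s t : A) : p - q + r + s - t + q = r - t + (s + p).
    rewrite -(addrA (p - q)) -(addrA (p - q)) [LHS]addrAC subrK addrC.
    by rewrite (addrAC r) -addrA.
  exact: regroup.
rewrite inner_mu inner_nu inner_rho inner_theta inner_F inner_G Omega0E.
have -> c : Ustar g (0 : 'Hom(h, A)) c = 0 by apply: comp_lfun0r.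
rewrite addr0 !UstarD !UstarN !coadB coadZ.
have regroup (o u v w k x y z b' : 'Hom(h, R^o)) :
    o + u + (v - w) + b' - x - (y - z + u + v - x) - 2^-1 *: z =
    o - y + 2^-1 *: (z + k) + (b' - w - 2^-1 *: k).
  apply/lfunP => Z; rewrite !(add_lfunE, opp_lfunE) !scale_lfunE add_lfunE.
  have regroup_real (o' u' v' w' k' x' y' z' t : R) :
      o' + u' + (v' - w') + t - x' - (y' - z' + u' + v' - x') - 2^-1 * z' =
      o' - y' + 2^-1 * (z' + k') + (t - w' - 2^-1 * k') by lra.
  exact: regroup_real.
exact: regroup.
Qed.

End Reduction.

(** * Triviality of the extension over a complete quadratic Lie algebra *)

Theorem theorem5p2 (R : realType) (h A : vectType R)
    (br : 'Hom(h, 'End(h))) (m : 'Hom(A, 'End(A)))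
    (g : 'Hom(A, 'Hom(A, R^o)))
    (F G : 'Hom(h, 'End(A))) (omega theta : 'Hom(h, 'Hom(h, A)))
    (Omega : 'Hom(h, 'Hom(h, 'Hom(h, R^o)))) :
  left_leibniz m -> L_quadratic m g -> lie_algebra br ->
  admissible br m g F G omega theta Omega ->
  lie_algebra m -> trivial_center m -> H2_trivial m ->
  exists (Omega0 : 'Hom(h, 'Hom(h, 'Hom(h, R^o)))) (U : 'Hom(h, A)),
    cocycle1 br Omega0 /\
    isomorphic (ext_mul br m g F G omega theta Omega) (ext_metric g)
               (circ_mul br m g Omega0 U) (circ_metric g U).
Proof.
move=> _ quad lie_h adm lie_A Z0 H2.
have inner X : exists v, m v = F X.
  apply: (skew_derivation_inner lie_A quad H2).
    exact: (adm_F_so adm).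
  exact: (adm_F_der adm).
have [V FV] := inner_lift Z0 inner.
have [Omega0 Omega0E] := reduced_exists br m g Omega V.
exists Omega0, 0; split.
  exact: (reduced_cocycle1 lie_h lie_A quad Z0 adm FV Omega0E).
have [f fE] := linear_hom (transvection_linear g V).
exists f; split=> [|x y|x y]; rewrite ?fE.
- exists (transvection g (- V)) => x; rewrite fE ?transvectionK //.
  by rewrite -{1}(opprK V) transvectionK.
- exact: (transvection_morphism lie_A quad Z0 adm FV).
- by rewrite circ_metric0 transvection_isometry //; case: quad.
Qed.
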